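(* Let $PG(2,q)$ be a projective plane of order $q$, and let $C_3(PG(2,q))$ be the hypergraph whose vertices are the points of the plane and whose hyperedges are the $3$-element circuits of the associated rank-$3$ matroid. Then $hc(C_3(PG(2,q)))=4$.
   Context: A projective plane of order $q$ ($q\ge 2$) is viewed as the rank-$3$ simple matroid on its points whose rank-$2$ flats are the lines; its circuits are the sets of $3$ collinear points and the sets of $4$ points with no three collinear. For an integer $t\ge 1$, a $t$-colouring of a hypergraph $H=(V,E)$ is a surjective function $\phi:V\to\{1,\dots,t\}$ (all colours must be used). A $t$-colouring $\phi$ is heterochromatic if there is a hyperedge $e\in E$ whose vertices receive pairwise distinct colours under $\phi$ (a totally multicoloured hyperedge). The heterochromatic number $hc(H)$ is the minimum $t\ge 1$ such that every $t$-colouring of $H$ is heterochromatic. *)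

(* Defs.v *)
From mathcomp Require Import all_boot.

Set Implicit Arguments.
Unset Strict Implicit.
Unset Printing Implicit Defensive.

(* A line is identified with the set of its points. *)
Record projective_plane (q : nat) (P : finType) (L : {set {set P}}) : Prop :=
  ProjectivePlane {
    plane_join : forall x y : P, x != y ->
      exists! l : {set P}, l \in L /\ [set x; y] \subset l;
    plane_meet : forall l m : {set P}, l \in L -> m \in L -> l != m ->
      exists! x : P, x \in l :&: m;
    plane_quadrangle : exists2 Q : {set P}, #|Q| = 4 &
      forall l : {set P}, l \in L -> #|Q :&: l| <= 2;
    plane_order : forall l : {set P}, l \in L -> #|l| = q.+1 }.

Record matroid (T : finType) := Matroid {
  indep : {set {set T}};
  indep0 : set0 \in indep;
  indepS : forall A B : {set T},
    A \subset B -> B \in indep -> A \in indep;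
  indep_augment : forall A B : {set T},
    A \in indep -> B \in indep -> #|A| < #|B| ->
    exists2 x : T, x \in B :\: A & x |: A \in indep }.

Section Matroid.
Variables (T : finType) (M : matroid T).

Definition mrank (A : {set T}) : nat :=
  \max_(I in indep M | I \subset A) #|I|.

Definition flat (F : {set T}) : bool :=
  [forall x, (x \notin F) ==> (mrank F < mrank (x |: F))].

Definition circuits : {set {set T}} :=
  [set C | minset [pred A : {set T} | A \notin indep M] C].

(* No circuit of size 1 (a loop) or 2 (a pair of parallel elements). *)
Definition simple_matroid : bool := [forall C in circuits, 2 < #|C|].

End Matroid.

(* These conditions determine M; such a matroid exists by
   plane_matroid_exists. *)
Record plane_matroid (P : finType) (L : {set {set P}}) (M : matroid P) : Prop :=
  PlaneMatroid {
    plane_matroid_simple : simple_matroid M;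
    plane_matroid_rank : mrank M [set: P] = 3;
    plane_matroid_lines : forall F : {set P},
      (F \in L) = flat M F && (mrank M F == 2) }.

Definition hypergraph (V : finType) := {set {set V}}.

Definition circuit_hypergraph (k : nat) (T : finType) (M : matroid T) :
    hypergraph T :=
  [set C in circuits M | #|C| == k].

Section Heterochromatic.
Variables (V : finType) (H : hypergraph V).

(* The colours 1, ..., t are represented by 'I_t. *)
Definition is_colouring (t : nat) (phi : {ffun V -> 'I_t}) : bool :=
  [forall c, exists v, phi v == c].

Definition heterochromatic (t : nat) (phi : {ffun V -> 'I_t}) : bool :=
  [exists e in H, dinjectiveb phi (mem e)].

Definition forces_heterochromatic (t : nat) : bool :=
  (0 < t) &&
  [forall phi : {ffun V -> 'I_t}, is_colouring phi ==> heterochromatic phi].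

(* There is no colouring with more colours than vertices. *)
Lemma forces_heterochromatic_exists : exists t, forces_heterochromatic t.
Proof.
exists #|V|.+1; apply/andP; split=> //; apply/forallP => phi.
apply/implyP => /forallP phi_surj.
have: #|'I_#|V|.+1| <= #|codom phi|.
  apply: subset_leq_card; apply/subsetP => c _.
  by have /existsP[v /eqP <-] := phi_surj c; apply: codom_f.
rewrite card_ord => lt_V; have := leq_trans lt_V (leq_image_card _ _).
by rewrite ltnn.
Qed.

Definition hc : nat := ex_minn forces_heterochromatic_exists.

End Heterochromatic.

Section PlaneMatroidExists.
Variables (q : nat) (P : finType) (L : {set {set P}}).
Hypotheses (q_ge2 : 2 <= q) (planeL : projective_plane q L).

Let ind : {set {set P}} :=
  [set I : {set P} | (#|I| <= 3) &&
     [forall l in L, (I \subset l) ==> (#|I| <= 2)]].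

Let indP (I : {set P}) :
  reflect (#|I| <= 3 /\ forall l, l \in L -> I \subset l -> #|I| <= 2)
          (I \in ind).
Proof.
rewrite inE; apply: (iffP andP) => [[le3 /forall_inP h]|[le3 h]]; split=> //.
  by move=> l lL sIl; have := h l lL; rewrite sIl.
by apply/forall_inP => l lL; apply/implyP; apply: h lL.
Qed.

Let ind_small (I : {set P}) : #|I| <= 2 -> I \in ind.
Proof. by move=> le2; apply/indP; split=> //; apply: leq_trans le2 _. Qed.

Let ind0 : set0 \in ind.
Proof. by apply: ind_small; rewrite cards0. Qed.

Let indS (A B : {set P}) : A \subset B -> B \in ind -> A \in ind.
Proof.
move=> sAB /indP[B3 hB]; have leAB := subset_leq_card sAB.
case: (leqP #|A| 2) => [|A3]; first exact: ind_small.
apply/indP; split=> [|l lL sAl]; first exact: leq_trans leAB B3.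
have eqAB : A = B.
  by apply/eqP; rewrite eqEcard sAB (leq_trans B3 A3).
by rewrite eqAB; apply: (hB l) => //; rewrite -eqAB.
Qed.

Let line_uniq (A l m : {set P}) : #|A| = 2 -> l \in L -> m \in L ->
  A \subset l -> A \subset m -> l = m.
Proof.
move=> /eqP/cards2P[x [y [xy ->]]] lL mL sl sm.
have [k [_ hk]] := plane_join planeL xy.
by rewrite -(hk l) // -(hk m).
Qed.

Let line_ex (A : {set P}) : #|A| = 2 -> exists2 l, l \in L & A \subset l.
Proof.
move=> /eqP/cards2P[x [y [xy ->]]].
by have [l [[lL sl] _]] := plane_join planeL xy; exists l.
Qed.

Let ind_ext (A l : {set P}) x : #|A| = 2 -> l \in L -> A \subset l ->
  x \notin l -> x |: A \in ind.
Proof.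
move=> A2 lL sAl xl; apply/indP; split=> [|m mL].
  by rewrite cardsU1 A2; case: (_ \notin _).
rewrite subUset sub1set => /andP[xm sAm].
by rewrite (line_uniq A2 lL mL sAl sAm) xm in xl.
Qed.

Let ind_augment (A B : {set P}) : A \in ind -> B \in ind -> #|A| < #|B| ->
  exists2 x : P, x \in B :\: A & x |: A \in ind.
Proof.
move=> _ /indP[B3 hB] ltAB.
case: (ltnP #|A| 2) => A2.
  have /subsetPn[x xB xA] : ~~ (B \subset A).
    by apply: contraL ltAB => /subset_leq_card; rewrite -leqNgt.
  exists x; first by rewrite inE xA.
  by apply: ind_small; rewrite cardsU1 xA.
have {}A2 : #|A| = 2.
  by apply/eqP; rewrite eqn_leq A2 andbT -ltnS; apply: leq_trans ltAB B3.
have [l lL sAl] := line_ex A2.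
have /subsetPn[x xB xl] : ~~ (B \subset l).
  by apply/negP => /(hB l lL); rewrite leqNgt -A2 ltAB.
exists x; last exact: ind_ext xl.
by rewrite inE xB andbT; apply: contra xl; apply: (subsetP sAl).
Qed.

Let M := Matroid ind0 indS ind_augment.

Let rank_ge (I A : {set P}) : I \in ind -> I \subset A -> #|I| <= mrank M A.
Proof.
by move=> iI sIA; apply: leq_bigmax_cond; rewrite iI.
Qed.

Let rank_le (A : {set P}) n :
  (forall I : {set P}, I \in ind -> I \subset A -> #|I| <= n) -> mrank M A <= n.
Proof. by move=> h; apply/bigmax_leqP => I /andP[]; apply: h. Qed.

Let pair_in (A : {set P}) : 1 < #|A| ->
  exists2 B : {set P}, #|B| = 2 & B \subset A.
Proof.
move=> /card_gt1P[x [y [xA yA xy]]]; exists [set x; y].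
  by rewrite cards2 xy.
by rewrite subUset !sub1set xA.
Qed.

Let line_rank l : l \in L -> mrank M l = 2.
Proof.
move=> lL; apply/eqP; rewrite eqn_leq; apply/andP; split.
  by apply: rank_le => I /indP[_ h]; apply: h.
have [|B B2 sB] := @pair_in l.
  by rewrite (plane_order planeL lL) ltnS ltnW.
by rewrite -B2; apply: rank_ge => //; apply: ind_small; rewrite B2.
Qed.

Lemma plane_matroid_exists : exists M : matroid P, plane_matroid L M.
Proof.
exists M; split.
- apply/forall_inP => C; rewrite inE => /minsetP[] /= nC _.
  by rewrite ltnNge; apply: contra nC; apply: ind_small.
- apply/eqP; rewrite eqn_leq; apply/andP; split.
    by apply: rank_le => I /indP[].
  have [Q Q4 hQ] := plane_quadrangle planeL.
  have [|A A2 sA] := @pair_in Q; first by rewrite Q4.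
  have [l lL sAl] := line_ex A2.
  have /subsetPn[x _ xl] : ~~ (Q \subset l).
    by apply/negP => /setIidPl eQ; have := hQ l lL; rewrite eQ Q4.
  have xA : x \notin A by apply: contra xl; apply: (subsetP sAl).
  have <- : #|x |: A| = 3 by rewrite cardsU1 xA A2.
  by apply: rank_ge; [apply: ind_ext xl | apply: subsetT].
move=> F; apply/idP/andP => [lL|[/forallP flatF /eqP rF]].
  split; last by rewrite line_rank.
  apply/forallP => x; apply/implyP => xF; rewrite line_rank //.
  have [|A A2 sA] := @pair_in F.
    by rewrite (plane_order planeL lL) ltnS ltnW.
  have xA : x \notin A by apply: contra xF; apply: (subsetP sA).
  have <- : #|x |: A| = 3 by rewrite cardsU1 xA A2.
  by apply: rank_ge; [apply: ind_ext xF | apply: setUS].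
have [|A A2 sA] := @pair_in F.
  rewrite -rF; apply: rank_le => I _; exact: subset_leq_card.
have [l lL sAl] := line_ex A2.
have sFl : F \subset l.
  apply/subsetP => x xF; apply: contraT => xl.
  have xA : x \notin A by apply: contra xl; apply: (subsetP sAl).
  have : #|x |: A| <= mrank M F.
    by apply: rank_ge; [apply: ind_ext xl | rewrite subUset sub1set xF].
  by rewrite cardsU1 xA A2 rF.
suff -> : F = l by [].
apply/eqP; rewrite eqEsubset sFl /=; apply/subsetP => x xl.
apply: contraT => xF; have := flatF x; rewrite xF rF /= ltnNge.
rewrite -(line_rank lL) => /negP[]; apply: rank_le => I iI sI.
apply: rank_ge => //; apply: subset_trans sI _.
by rewrite subUset sub1set xl.
Qed.

End PlaneMatroidExists.

(* Main.v *)
Require Import Defs.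
From mathcomp Require Import all_boot.

Set Implicit Arguments.
Unset Strict Implicit.
Unset Printing Implicit Defensive.

(** The 3-element circuits of the plane matroid are the collinear triples
    ([circuit3_collinear]), so a colouring is heterochromatic exactly when some
    line carries three colours.

    Three colours do not force this: give a point [x] the first colour, the
    other points of a line [l] through [x] the second, and the points off [l]
    the third.  A line through [x] other than [l] meets [l] only in [x] and so
    misses the second colour; [l] misses the third, and a line avoiding [x]
    misses the first.  Identifying colours cannot create a heterochromatic
    triple, so this also settles one and two colours ([not_forces_le3]).

    Four colours do: were every line at most bicoloured, the line joining
    points of colours 0 and 1 and the line joining points of colours 2 and 3
    would carry disjoint sets of colours, yet any two lines of a projective
    plane meet ([forces_ge4]). *)

Section SimpleMatroid.
Variables (T : finType) (M : matroid T).
Hypothesis simpleM : simple_matroid M.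

Lemma simple_indep2 (A : {set T}) : #|A| <= 2 -> A \in indep M.
Proof.
move=> A2; apply: contraT => depA.
have [C minC sCA] := @minset_exists _ [pred B : {set T} | B \notin indep M] A depA.
have /forall_inP/(_ C) := simpleM; rewrite inE => /(_ minC).
by rewrite ltnNge (leq_trans (subset_leq_card sCA) A2).
Qed.

Lemma simple_circuit3 (A : {set T}) :
  #|A| = 3 -> (A \in circuits M) = (A \notin indep M).
Proof.
move=> A3; rewrite inE; apply/minsetP/idP => [[]//|depA]; split=> // B depB sBA.
apply/eqP; rewrite eqEcard sBA A3 ltnNge.
by apply: contra depB => /simple_indep2.
Qed.

Lemma mrank_indep (I A : {set T}) :
  I \in indep M -> I \subset A -> #|I| <= mrank M A.
Proof. by move=> iI sIA; apply: leq_bigmax_cond; rewrite iI. Qed.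

Lemma mrank_witness (A : {set T}) :
  exists I : {set T}, [/\ I \in indep M, I \subset A & #|I| = mrank M A].
Proof.
pose indepA := [pred I : {set T} | (I \in indep M) && (I \subset A)].
have [|I /andP[iI sIA] rI] := @eq_bigmax_cond _ indepA (fun I => #|I|).
  by apply/card_gt0P; exists set0; rewrite inE indep0 sub0set.
by exists I; rewrite /mrank rI.
Qed.

(** Leaving a rank-2 flat raises the rank, and augmenting the pair from a
    basis of the enlarged set can only add the new point: any other element
    would complete an independent triple inside the flat. *)
Lemma indep_flat2_ext (F A : {set T}) x :
    flat M F -> mrank M F = 2 -> A \subset F -> #|A| = 2 -> x \notin F ->
  x |: A \in indep M.
Proof.
move=> /forallP/(_ x) flatF rF sAF A2 xF; rewrite xF rF /= in flatF.
have [I [iI sI cI]] := mrank_witness (x |: F).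
have [||y /setDP[yI yA] iyA] := @indep_augment _ M A I _ iI.
- by apply: simple_indep2; rewrite A2.
- by rewrite A2 cI.
have /setU1P[<- //|yF] := subsetP sI y yI.
have : #|y |: A| <= mrank M F.
  by apply: mrank_indep iyA _; rewrite subUset sub1set yF.
by rewrite rF cardsU1 yA A2.
Qed.

End SimpleMatroid.

Section Plane.
Variables (q : nat) (P : finType) (L : {set {set P}}).
Hypothesis planeL : projective_plane q L.

Lemma line_through x y :
  x != y -> exists l : {set P}, [/\ l \in L, x \in l & y \in l].
Proof.
case/(plane_join planeL) => l [[lL]].
by rewrite subUset !sub1set => /andP[xl yl] _; exists l.
Qed.

Lemma line_unique x y (l m : {set P}) : x != y -> l \in L -> m \in L ->
  x \in l -> y \in l -> x \in m -> y \in m -> l = m.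
Proof.
case/(plane_join planeL) => k [_ k_uniq] lL mL xl yl xm ym.
rewrite -(k_uniq l) -1?(k_uniq m) //.
  by rewrite subUset !sub1set xm.
by rewrite subUset !sub1set xl.
Qed.

Lemma lines_intersect (l m : {set P}) :
  l \in L -> m \in L -> l != m -> exists2 x, x \in l & x \in m.
Proof.
by move=> lL mL /(plane_meet planeL lL mL)[x [/setIP[xl xm] _]]; exists x.
Qed.

Lemma plane_frame : exists x y z (l : {set P}),
  [/\ l \in L, x \in l, y \in l, x != y & z \notin l].
Proof.
have [Q Q4 line_le2] := plane_quadrangle planeL.
have /card_gt1P[x [y [_ _ xy]]] : 1 < #|Q| by rewrite Q4.
have [l [lL xl yl]] := line_through xy.
have /subsetPn[z _ zl] : ~~ (Q \subset l).
  by apply/negP => /setIidPl eQ; have := line_le2 l lL; rewrite eQ Q4.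
by exists x, y, z, l.
Qed.

Variable M : matroid P.
Hypothesis planeM : plane_matroid L M.

Lemma circuit3_collinear (C : {set P}) :
  (C \in circuit_hypergraph 3 M) = (#|C| == 3) && [exists l in L, C \subset l].
Proof.
have simM := plane_matroid_simple planeM.
rewrite inE andbC; case: eqP => //= C3; rewrite simple_circuit3 //.
apply/idP/exists_inP => [depC | [l lL sCl]].
  have /card_gt0P[c cC] : 0 < #|C| by rewrite C3.
  have A2 : #|C :\ c| = 2 by move: C3; rewrite (cardsD1 c) cC => -[].
  have /eqP/cards2P[x [y [xy defA]]] := A2.
  have [l [lL xl yl]] := line_through xy; exists l => //.
  have sAl : C :\ c \subset l by rewrite defA subUset !sub1set xl.
  have := lL; rewrite (plane_matroid_lines planeM) => /andP[flatl /eqP rl].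
  rewrite -(setD1K cC) subUset sub1set sAl andbT.
  apply: contraR depC => cl; rewrite -(setD1K cC).
  exact: (indep_flat2_ext simM flatl rl).
have := lL; rewrite (plane_matroid_lines planeM) => /andP[_ /eqP rl].
by apply/negP => /(mrank_indep)/(_ sCl); rewrite rl C3.
Qed.

Lemma line_bicoloured t (phi : {ffun P -> 'I_t}) (l : {set P}) a b p :
    ~~ heterochromatic (circuit_hypergraph 3 M) phi -> l \in L ->
    a \in l -> b \in l -> p \in l -> phi a != phi b ->
  phi p \in [set phi a; phi b].
Proof.
move=> nhet lL al bl pl ab; apply: contraR nhet.
rewrite !inE negb_or => /andP[pa pb].
(* The image of the triple already has three elements, which bounds its size
   from below and makes [phi] injective on it. *)
have im3 : #|phi @: [set p; a; b]| = 3.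
  by rewrite !imsetU !imset_set1 -setUA cardsU1 cards2 !inE (negPf pa) (negPf pb) ab.
have e_le3 : #|[set p; a; b]| <= 3.
  by rewrite -setUA cardsU1 cards2; case: (_ \notin _); case: (_ != _).
have e3 : #|[set p; a; b]| = 3.
  by apply/eqP; rewrite eqn_leq e_le3 -{1}im3 leq_imset_card.
apply/exists_inP; exists [set p; a; b].
  rewrite circuit3_collinear e3 eqxx /=; apply/exists_inP; exists l => //.
  by rewrite !subUset !sub1set pl al bl.
by apply/dinjectiveP/imset_injP; rewrite im3 e3.
Qed.

Lemma forces_ge4 t :
  4 <= t -> forces_heterochromatic (circuit_hypergraph 3 M) t.
Proof.
case: t => // t t4; apply/andP; split=> //; apply/forallP => phi.
apply/implyP => /forallP phi_surj; apply: contraT => nhet.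
have colour k : k < 4 -> exists a, phi a = k :> nat.
  move=> k4; have /existsP[a /eqP phi_a] := phi_surj (inord k).
  by exists a; rewrite phi_a inordK // (leq_trans k4).
have [a phi_a] := colour 0 isT; have [b phi_b] := colour 1 isT.
have [c phi_c] := colour 2 isT; have [d phi_d] := colour 3 isT.
have neq_phi u v : phi u != phi v -> u != v by apply: contra_neq => ->.
have ab : phi a != phi b by rewrite -val_eqE /= phi_a phi_b.
have cd : phi c != phi d by rewrite -val_eqE /= phi_c phi_d.
have [l [lL al bl]] := line_through (neq_phi _ _ ab).
have [m [mL cm dm]] := line_through (neq_phi _ _ cd).
have on_l p : p \in l -> phi p < 2.
  move=> pl; have := line_bicoloured nhet lL al bl pl ab.
  by rewrite !inE -!val_eqE /= phi_a phi_b => /orP[]/eqP->.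
have on_m p : p \in m -> 2 <= phi p.
  move=> pm; have := line_bicoloured nhet mL cm dm pm cd.
  by rewrite !inE -!val_eqE /= phi_c phi_d => /orP[]/eqP->.
have lm : l != m.
  by apply: contraTneq cm => <-; apply/negP => /on_l; rewrite phi_c.
have [p /on_l p_lt2 /on_m] := lines_intersect lL mL lm.
by rewrite leqNgt p_lt2.
Qed.

Definition flag_colour (x : P) (l : {set P}) (p : P) : 'I_3 :=
  if p == x then inord 0 else if p \in l then inord 1 else inord 2.

Lemma flag_colour_misses x (l m : {set P}) :
    l \in L -> m \in L -> x \in l ->
  exists k, forall p, p \in m -> flag_colour x l p != k.
Proof.
have neq_inord i j : i < 3 -> j < 3 -> i != j -> inord i != inord j :> 'I_3.
  by move=> i3 j3; rewrite -val_eqE /= !inordK.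
move=> lL mL xl; case: (boolP (x \in m)) => xm; last first.
  exists (inord 0) => p pm; rewrite /flag_colour.
  have /negPf-> : p != x by apply: contraNneq xm => <-.
  by case: ifP => _; apply: neq_inord.
case: (eqVneq m l) => [->|ml].
  exists (inord 2) => p pl; rewrite /flag_colour pl.
  by case: ifP => _; apply: neq_inord.
exists (inord 1) => p pm; rewrite /flag_colour.
case: (eqVneq p x) => [_|px]; first exact: neq_inord.
case: ifP => pl; last exact: neq_inord.
by rewrite (line_unique px mL lL) ?eqxx in ml.
Qed.

Lemma not_forces_le3 t :
  t <= 3 -> ~~ forces_heterochromatic (circuit_hypergraph 3 M) t.
Proof.
case: t => // t t3; have [x [y [z [l [lL xl yl xy zl]]]]] := plane_frame.
(* [inord] sends the colours outside 'I_t.+1 to colour 0, which identifies them. *)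
pose phi := [ffun p => inord (flag_colour x l p) : 'I_t.+1].
apply/negP => /andP[_ /forallP/(_ phi)/implyP h].
have /h/exists_inP[e] : is_colouring phi.
  apply/forallP => c.
  have [p fp] : exists p, flag_colour x l p = c :> nat.
    have : c < 3 := leq_trans (ltn_ord c) t3.
    rewrite /flag_colour; case: (nat_of_ord c) => [|[|[|//]]] _.
    - by exists x; rewrite eqxx inordK.
    - by exists y; rewrite eq_sym (negPf xy) yl inordK.
    exists z; have /negPf-> : z != x by apply: contraNneq zl => ->.
    by rewrite (negPf zl) inordK.
  by apply/existsP; exists p; rewrite ffunE fp inord_val.
rewrite circuit3_collinear => /andP[/eqP e3 /exists_inP[m mL sem]].
move=> /dinjectiveP phi_inj.
have [k miss] := flag_colour_misses lL mL xl.
have flag_inj : {in e &, injective (flag_colour x l)}.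
  by move=> u v ue ve eq_uv; apply: phi_inj; rewrite // !ffunE eq_uv.
have : #|flag_colour x l @: e| <= #|[set~ k]|.
  apply/subset_leq_card/subsetP => _ /imsetP[p pe ->].
  by rewrite !inE; apply: miss; apply: (subsetP sem).
by rewrite (card_in_imset flag_inj) e3 cardsC1 card_ord.
Qed.

End Plane.

Theorem theorem4p1 (q : nat) (hq : 2 <= q) (P : finType) (L : {set {set P}})
    (hL : projective_plane q L) (M : matroid P) (hM : plane_matroid L M) :
  hc (circuit_hypergraph 3 M) = 4.
Proof.
rewrite /hc; case: ex_minnP => t forces_t t_min; apply/eqP; rewrite eqn_leq.
rewrite t_min ?(forces_ge4 hL hM) //= ltnNge.
by apply: contraL forces_t; apply: not_forces_le3 hL _ hM _.
Qed.
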